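(* (a) A simple graph parameter $f$ is testable if and only if $f(G_n)$ converges for every convergent sequence $(G_n)$ of simple graphs with $|V(G_n)|\to\infty$. (b) A sequence $(G_n)$ of simple graphs with $|V(G_n)|\to\infty$ is convergent if and only if $f(G_n)$ converges for every testable simple graph parameter $f$.
   Context: A simple graph is a finite graph (nonempty node set) without loops or multiple edges. A simple graph parameter is a real-valued function on simple graphs that is invariant under relabeling of the nodes (isomorphism). For simple graphs $F,G$, $t(F,G)=\hom(F,G)/|V(G)|^{|V(F)|}$, where $\hom(F,G)$ is the number of adjacency-preserving maps $V(F)\to V(G)$. A sequence $(G_n)$ of simple graphs is convergent (from the left) if $t(F,G_n)$ converges for every simple graph $F$. For a simple graph $G$ and $k\le|V(G)|$, $\mathbb G(k,G)$ is the random induced subgraph $G[S]$, where $S$ is chosen uniformly from all $k$-element subsets of $V(G)$. A graph parameter $f$ is testable if for every $\varepsilon>0$ there is a positive integer $k$ such that if $G$ is a graph with at least $k$ nodes, then from the random subgraph $\mathbb G(k,G)$ one can compute an estimate $\widetilde f$ of $f$ (i.e. $\widetilde f$ is a function of $\mathbb G(k,G)$) such that $\Pr(|f(G)-\widetilde f|>\varepsilon)\le\varepsilon$. (It is an easy observation that one can always use $\widetilde f=f(\mathbb G(k,G))$.) ''Converges'' means converges to a finite real limit. *)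

(* Defs.v *)
From mathcomp Require Import all_boot all_order all_algebra.
From mathcomp Require Import all_classical all_reals all_analysis.

Set Implicit Arguments.
Unset Strict Implicit.
Unset Printing Implicit Defensive.

Import Order.TTheory GRing.Theory Num.Theory.
Import numFieldNormedType.Exports.

Local Open Scope ring_scope.

Record sgraph := SGraph {
  vert :> finType;
  adj : rel vert;
  adj_sym : symmetric adj;
  adj_irr : irreflexive adj;
  vert_gt0 : (0 < #|vert|)%N }.

Arguments adj {s} x y.

Definition isomorphic (F G : sgraph) : Prop :=
  exists2 h : F -> G, bijective h & forall x y, adj (h x) (h y) = adj x y.

Definition graph_parameter (R : realType) (f : sgraph -> R) : Prop :=
  forall F G : sgraph, isomorphic F G -> f F = f G.

Definition is_hom (F G : sgraph) (h : {ffun F -> G}) : bool :=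
  [forall x, forall y, adj x y ==> adj (h x) (h y)].

Definition hom (F G : sgraph) : nat := #|[pred h | @is_hom F G h]|.

Definition hom_density (R : realType) (F G : sgraph) : R :=
  (hom F G)%:R / (#|G| ^ #|F|)%:R.

Definition order_to_infty (G : nat -> sgraph) : Prop :=
  ((fun n => #|G n|) @ \oo --> \oo)%classic.

Definition left_convergent (R : realType) (G : nat -> sgraph) : Prop :=
  forall F : sgraph, cvg ((fun n => hom_density R F (G n)) @ \oo)%classic.

Section Induced.
Variables (G : sgraph) (S : {set G}).

Definition induced_adj : rel {x : G | x \in S} :=
  fun x y => adj (val x) (val y).

Lemma induced_adj_sym : symmetric induced_adj.
Proof. by move=> x y; exact: adj_sym. Qed.

Lemma induced_adj_irr : irreflexive induced_adj.
Proof. by move=> x; exact: adj_irr. Qed.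

Lemma induced_vert_gt0 : (0 < #|S|)%N -> (0 < #|{: {x : G | x \in S}}|)%N.
Proof. by rewrite card_sig. Qed.

Definition induced (S0 : (0 < #|S|)%N) : sgraph :=
  SGraph induced_adj_sym induced_adj_irr (induced_vert_gt0 S0).

End Induced.

Definition ksubset (G : sgraph) (k : nat) := {S : {set G} | #|S| == k}.

Lemma ksubset_gt0 (G : sgraph) (k : nat) (S : ksubset G k) :
  (0 < k)%N -> (0 < #|val S|)%N.
Proof. by rewrite (eqP (valP S)). Qed.

Definition sample (G : sgraph) (k : nat) (k0 : (0 < k)%N) (S : ksubset G k) :
  sgraph := induced (ksubset_gt0 S k0).

(* The probability that the random induced subgraph G[S], with S uniform among
   the k-subsets of the nodes, satisfies P. *)
Definition sample_prob (R : realType) (G : sgraph) (k : nat) (k0 : (0 < k)%N)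
    (P : pred sgraph) : R :=
  #|[pred S : ksubset G k | P (sample k0 S)]|%:R / #|{: ksubset G k}|%:R.

(* The estimate is a function of the isomorphism type of the sample only, and
   does not depend on G.  Without invariance it could exploit the names of the
   sampled nodes. *)
Definition testable (R : realType) (f : sgraph -> R) : Prop :=
  forall eps : R, 0 < eps ->
  exists (k : nat) (k0 : (0 < k)%N) (est : sgraph -> R),
    graph_parameter est /\
    forall G : sgraph, (k <= #|G|)%N ->
      sample_prob R G k0 (fun H => eps < `|f G - est H|) <= eps.

(* Main.v *)
(* If [f] is testable and [(G_n)] converges, then the densities of all labelled
   patterns on [k] nodes converge by inclusion-exclusion; hence for large [m]
   and [n] the [k]-samples of [G_m] and [G_n] have nearly the same distribution,
   some [k]-node graph is a good sample of both, and [f (G_m)], [f (G_n)] are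
   both close to its estimate.

   Conversely, if [f] converges along convergent sequences, then by compactness
   and interlacing of two sequences [f] varies little between large graphs whose
   densities [t(F_j, _)] agree approximately for finitely many [j].  A uniform
   [k]-subset [S] has [t(F_j, G[S])] close to [t(F_j, G)] with high probability
   (second moment method), so [f (G[S])] is a valid estimate.

   Part (b) is part (a) applied to the parameters [t(F, _)]. *)
Require Import Defs.
From mathcomp Require Import all_boot all_order all_algebra.
From mathcomp Require Import all_classical all_reals all_analysis.
From mathcomp Require Import lra ring zify.

Set Implicit Arguments.
Unset Strict Implicit.
Unset Printing Implicit Defensive.

Import Defs Order.TTheory GRing.Theory Num.Theory.
Import numFieldNormedType.Exports.

Local Open Scope ring_scope.

(** * Isomorphism invariance and bounds for homomorphism densities *)

Lemma bij_card (S T : finType) (f : S -> T) (P : pred S) (Q : pred T) :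
  bijective f -> (forall x, P x = Q (f x)) -> #|P| = #|Q|.
Proof.
move=> [g fK gK] PQ; rewrite -(fintype.card_image (can_inj fK) P); apply: eq_card => y.
apply/fintype.imageP/idP => [[x Px ->]|Qy]; first by rewrite unfold_in -PQ.
by exists (g y); rewrite ?gK // unfold_in PQ gK.
Qed.

Lemma isomorphic_card (F G : sgraph) : isomorphic F G -> #|F| = #|G|.
Proof. by move=> [h hb _]; apply: bij_eq_card hb. Qed.

Lemma is_homP (F G : sgraph) (h : {ffun F -> G}) :
  reflect (forall x y, adj x y -> adj (h x) (h y)) (is_hom h).
Proof.
apply: (iffP forallP) => [H x y|H x].
  by have /forallP/(_ y)/implyP := H x.
by apply/forallP => y; apply/implyP; apply: H.
Qed.

Lemma hom_isol (F F' G : sgraph) : isomorphic F F' -> hom F G = hom F' G.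
Proof.
move=> [h [g hK gK] hadj].
apply: (bij_card (f := fun u : {ffun F -> G} => [ffun x => u (g x)])).
  by exists (fun u : {ffun F' -> G} => [ffun x => u (h x)]) => u;
    apply/ffunP => x; rewrite !ffunE ?hK ?gK.
move=> u; apply/is_homP/is_homP => H x y xy.
  by rewrite !ffunE; apply: H; rewrite -hadj !gK.
by have := H (h x) (h y); rewrite !ffunE !hK hadj; apply.
Qed.

Lemma hom_isor (F G G' : sgraph) : isomorphic G G' -> hom F G = hom F G'.
Proof.
move=> [h [g hK gK] hadj].
apply: (bij_card (f := fun u : {ffun F -> G} => [ffun x => h (u x)])).
  by exists (fun u : {ffun F -> G'} => [ffun x => g (u x)]) => u;
    apply/ffunP => x; rewrite !ffunE ?hK ?gK.
move=> u; apply/is_homP/is_homP => H x y xy.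
  by rewrite !ffunE hadj; apply: H.
by have := H x y xy; rewrite !ffunE hadj.
Qed.

Lemma hom_density_isol (R : realType) (F F' G : sgraph) :
  isomorphic F F' -> hom_density R F G = hom_density R F' G.
Proof.
by move=> FF'; rewrite /hom_density (hom_isol G FF') (isomorphic_card FF').
Qed.

Lemma hom_density_graph_parameter (R : realType) (F : sgraph) :
  graph_parameter (hom_density R F).
Proof.
by move=> G G' GG'; rewrite /hom_density (hom_isor F GG') (isomorphic_card GG').
Qed.

Lemma hom_density_ge0 (R : realType) (F G : sgraph) : 0 <= hom_density R F G.
Proof. by rewrite divr_ge0. Qed.

Lemma hom_le (F G : sgraph) : (hom F G <= #|G| ^ #|F|)%N.
Proof. by rewrite -card_ffun max_card. Qed.

Lemma hom_density_le1 (R : realType) (F G : sgraph) : hom_density R F G <= 1.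
Proof.
rewrite /hom_density ler_pdivrMr ?mul1r ?ler_nat ?hom_le //.
by rewrite ltr0n expn_gt0 vert_gt0.
Qed.

(** * Disjoint unions and multiplicativity of densities *)

Section DisjointUnion.
Variables F G : sgraph.

Definition union_adj : rel (F + G) := fun u v =>
  match u, v with
  | inl x, inl y => adj x y
  | inr x, inr y => adj x y
  | _, _ => false
  end.

Lemma union_adj_sym : symmetric union_adj.
Proof. by move=> [x|x] [y|y] //=; apply: adj_sym. Qed.

Lemma union_adj_irr : irreflexive union_adj.
Proof. by move=> [x|x] /=; apply: adj_irr. Qed.

Lemma union_vert_gt0 : (0 < #|{: F + G}|)%N.
Proof. by rewrite card_sum addn_gt0 vert_gt0. Qed.

Definition graph_union : sgraph :=
  SGraph union_adj_sym union_adj_irr union_vert_gt0.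

End DisjointUnion.

Lemma hom_union (F F' G : sgraph) :
  hom (graph_union F F') G = (hom F G * hom F' G)%N.
Proof.
rewrite /hom -cardX.
apply: (bij_card (f := fun u : {ffun F + F' -> G} =>
   ([ffun x => u (inl x)], [ffun x => u (inr x)]) : {ffun F -> G} * {ffun F' -> G})).
  exists (fun p : {ffun F -> G} * {ffun F' -> G} =>
    [ffun u : F + F' => match u return G with inl x => p.1 x | inr x => p.2 x end]).
    by move=> u; apply/ffunP => -[x|x]; rewrite !ffunE.
  by move=> [p q]; congr pair; apply/ffunP => x; rewrite !ffunE.
move=> u; apply/is_homP/andP => [H|[/is_homP Hl /is_homP Hr]].
  by split; apply/is_homP => x y xy; rewrite !ffunE; apply: H.
move=> [x|x] [y|y] //= xy.
  by have := Hl x y xy; rewrite !ffunE.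
by have := Hr x y xy; rewrite !ffunE.
Qed.

Lemma hom_density_union (R : realType) (F F' G : sgraph) :
  hom_density R (graph_union F F') G = hom_density R F G * hom_density R F' G.
Proof.
rewrite /hom_density hom_union card_sum expnD !natrM.
by rewrite mulf_div.
Qed.

(** * Double counting of subsets and injections *)

Lemma card_ffun_sub (V T : finType) (S : {set T}) (Q : pred {ffun V -> T}) :
  #|[pred u : {ffun V -> {x | x \in S}} | Q [ffun x => val (u x)]]| =
  #|[pred h | Q h & [forall x, h x \in S]]|.
Proof.
pose e (u : {ffun V -> {x | x \in S}}) : {ffun V -> T} := [ffun x => val (u x)].
have e_inj : ssrfun.injective e.
  move=> u v uv; apply/ffunP => x; apply: val_inj.
  by have := congr1 (fun w : {ffun V -> T} => w x) uv; rewrite !ffunE.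
rewrite -(fintype.card_image e_inj); apply: eq_card => h.
apply/fintype.imageP/andP => [[u Qu ->]|[Qh /forallP hS]].
  by split; [exact: Qu | apply/forallP => x; rewrite ffunE; exact: valP].
have eh : e [ffun x => exist (fun y => y \in S) (h x) (hS x)] = h.
  by apply/ffunP => x; rewrite !ffunE.
exists [ffun x => exist (fun y => y \in S) (h x) (hS x)]; last by rewrite eh.
by rewrite unfold_in -/(e _) eh.
Qed.

(** Complementation turns the [k]-sets containing [A] into the subsets of [~: A] of size
    [#|G| - k]. *)
Lemma card_ksubset_sup (G : sgraph) (k : nat) (A : {set G}) :
  (#|A| <= k <= #|G|)%N ->
  #|[pred S : ksubset G k | A \subset val S]| = 'C(#|G| - #|A|, k - #|A|).
Proof.
move=> /andP[Ak kn].
have vC_inj : ssrfun.injective (fun S : ksubset G k => ~: val S).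
  by move=> S S' /finset.setC_inj /val_inj.
rewrite -(fintype.card_image vC_inj).
have cA : #|~: A| = (#|G| - #|A|)%N by rewrite (cardsCs (~: A)) finset.setCK.
have /bin_sub <- : (k - #|A| <= #|G| - #|A|)%N by rewrite leq_sub2r.
rewrite -cA -cards_draws; apply: eq_card => B; rewrite !inE.
apply/fintype.imageP/andP => [[S AS ->]|[BA /eqP cB]].
  rewrite finset.setCS; split => //; rewrite (cardsCs (~: val S)) finset.setCK (eqP (valP S)) cA.
 
  by apply/eqP; lia.
have cBk : #|~: B| == k by apply/eqP; rewrite (cardsCs (~: B)) finset.setCK cB cA; lia.
exists (exist (fun S : {set G} => #|S| == k) (~: B) cBk); last by rewrite /= finset.setCK.
by rewrite unfold_in /= finset.subsetC.
Qed.

Lemma card_ksubset (G : sgraph) (k : nat) :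
  (k <= #|G|)%N -> #|{: ksubset G k}| = 'C(#|G|, k).
Proof.
move=> kn; have := @card_ksubset_sup G k finset.set0; rewrite cards0 !subn0 => <- //.
by apply: eq_card => S; rewrite !inE finset.sub0set.
Qed.

(** Double counting of pairs [(S, h)]: the image of an injective [h] has [#|V|] elements, so the
    number of [k]-subsets containing it does not depend on [h]. *)
Lemma sum_inj_ksubset (V : finType) (G : sgraph) (k : nat)
    (Q : pred {ffun V -> G}) : (#|V| <= k <= #|G|)%N ->
  (\sum_(S : ksubset G k)
      #|[pred h : {ffun V -> G} | Q h && injectiveb h & [forall x, h x \in val S]]| =
   #|[pred h : {ffun V -> G} | Q h && injectiveb h]| *
     'C(#|G| - #|V|, k - #|V|))%N.
Proof.
move=> mk; under eq_bigr do rewrite -sum1_card big_mkcondr /=.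
rewrite exchange_big /= -sum_nat_const; apply: eq_bigr => h /andP[_ /injectiveP hinj].
have cV : #|h @: [set: V]%SET| = #|V| by rewrite card_imset ?cardsT.
rewrite -big_mkcond sum1_card -{}cV in mk *; rewrite -card_ksubset_sup //.
apply: eq_card => S; rewrite !inE; apply/forallP/fintype.subsetP => [H y /imsetP[x _ ->]|H x] //.
by apply: H; apply: imset_f.
Qed.

(** Both sides count the pairs of a [k]-subset of an [n]-set and an injective [m]-sequence inside
    it. *)
Lemma bin_ffact_sub (n k m : nat) : (m <= k <= n)%N ->
  ('C(n - m, k - m) * n ^_ m = 'C(n, k) * k ^_ m)%N.
Proof.
move=> /andP[mk kn]; have mn := leq_trans mk kn.
have e1 := bin_fact (leq_sub2r m kn); have e2 := bin_fact kn.
have e3 := ffact_fact mk; have e4 := ffact_fact mn.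
have nk : (n - m - (k - m) = n - k)%N by lia.
rewrite nk in e1.
have p : (0 < (k - m)`! * (n - k)`!)%N by rewrite muln_gt0 !fact_gt0.
apply/eqP; rewrite -(eqn_pmul2r p); apply/eqP.
rewrite mulnAC e1 mulnC e4 -e2 -e3; lia.
Qed.

(** * Homomorphisms against injective homomorphisms *)

Lemma ffact_le_expn (n m : nat) : (n ^_ m <= n ^ m)%N.
Proof. by elim: m => // j IHj; rewrite ffactnSr expnSr leq_mul // leq_subr. Qed.

(** The left side is the share of non-injective maps from an [m]-set to an [n]-set. Passing from [m]
    to [m.+1] raises it by at most [m / n], also for [m > n], where the new factor is truncated to
    0. *)
Lemma ffact_expn_ratio (R : realType) (n m : nat) : (0 < n)%N ->
  1 - (n ^_ m)%:R / (n ^ m)%:R <= (m ^ 2)%:R / n%:R :> R.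
Proof.
move=> n0; have n0R : 0 < n%:R :> R by rewrite ltr0n.
elim: m => [|m IH]; first by rewrite ffactn0 expn0 divr1 subrr exp0n // mul0r.
rewrite ffactnSr expnSr !natrM -mulf_div.
set r := _ / (n ^ m)%:R in IH *.
have r0 : 0 <= r by rewrite divr_ge0.
have r1 : r <= 1.
  rewrite ler_pdivrMr ?ltr0n ?expn_gt0 ?n0 // mul1r ler_nat.
  exact: ffact_le_expn.
have nm : 1 - m%:R / n%:R <= (n - m)%:R / n%:R :> R.
  rewrite lerBlDr -mulrDl ler_pdivlMr // mul1r -natrD ler_nat; lia.
have mn0 : 0 <= m%:R / n%:R :> R by rewrite divr_ge0.
have h1 : r * (1 - m%:R / n%:R) <= r * ((n - m)%:R / n%:R) by rewrite ler_wpM2l.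
have h2 : (m ^ 2)%:R / n%:R + m%:R / n%:R <= (m.+1 ^ 2)%:R / n%:R :> R.
  rewrite -mulrDl ler_wpM2r ?invr_ge0 // -natrD ler_nat; lia.
nra.
Qed.

Definition injhom (F G : sgraph) : nat :=
  #|[pred h : {ffun F -> G} | is_hom h && injectiveb h]|.

Lemma card_noninj (V T : finType) :
  (#|[pred h : {ffun V -> T} | ~~ injectiveb h]| = #|T| ^ #|V| - #|T| ^_ #|V|)%N.
Proof.
rewrite -card_ffun -card_inj_ffuns cardsE -(cardC [pred h : {ffun V -> T} | injectiveb h]).
by rewrite addKn; apply: eq_card.
Qed.

Lemma hom_injhom (F G : sgraph) :
  (injhom F G <= hom F G <= injhom F G + (#|G| ^ #|F| - #|G| ^_ #|F|))%N.
Proof.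
rewrite -card_noninj /hom -(cardID [pred h : {ffun F -> G} | injectiveb h]).
set a := #|[predI _ & _]|; have -> : injhom F G = a by apply: eq_card.
rewrite leq_addr leq_add2l; apply: subset_leq_card; apply/fintype.subsetP => h.
by rewrite !inE => /andP[].
Qed.

Lemma injhom_le (F G : sgraph) : (injhom F G <= #|G| ^_ #|F|)%N.
Proof.
rewrite -card_inj_ffuns; apply: subset_leq_card; apply/fintype.subsetP => h.
by rewrite !inE => /andP[].
Qed.

(** Normalising by the falling factorial makes the average over samples exact. For [#|G| < #|F|] the
    quotient is 0/0, hence 0. *)
Definition injhom_density (R : realType) (F G : sgraph) : R :=
  (injhom F G)%:R / (#|G| ^_ #|F|)%:R.

Lemma hom_injhom_density (R : realType) (F G : sgraph) :
  `|hom_density R F G - injhom_density R F G| <= (#|F| ^ 2)%:R / #|G|%:R.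
Proof.
apply: le_trans (ffact_expn_ratio R #|F| (vert_gt0 G)).
have /andP[ih hi] := hom_injhom F G.
have iff := injhom_le F G; have fe := ffact_le_expn #|G| #|F|.
have e0 : 0 < (#|G| ^ #|F|)%:R :> R by rewrite ltr0n expn_gt0 vert_gt0.
rewrite /hom_density /injhom_density.
move: (hom F G) (injhom F G) (#|G| ^ #|F|)%N (#|G| ^_ #|F|)%N ih hi iff fe e0.
move=> h i e f ih hi i_f fe e0.
have ihR : i%:R <= h%:R :> R by rewrite ler_nat.
have hiR : h%:R <= i%:R + (e%:R - f%:R) :> R by rewrite -natrB // -natrD ler_nat.
(* Here [f] stands for [#|G| ^_ #|F|], which vanishes exactly when [G] has fewer nodes than [F]; the
   injective density is then 0 by convention. *)
have [f0|f0] := posnP f.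
  rewrite f0 in i_f hiR *; rewrite invr0 mulr0 subr0 mul0r subr0.
  rewrite ger0_norm ?divr_ge0 // ler_pdivrMr // mul1r.
  have i0 : i%:R = 0 :> R by move: i_f; rewrite leqn0 => /eqP ->.
  by move: hiR; rewrite i0 add0r subr0.
have f0R : 0 < f%:R :> R by rewrite ltr0n.
have ifR : i%:R <= f%:R :> R by rewrite ler_nat.
have feR : f%:R <= e%:R :> R by rewrite ler_nat.
have i0 : 0 <= i%:R :> R by [].
move: (h%:R : R) (i%:R : R) (e%:R : R) (f%:R : R) e0 ihR hiR f0R ifR feR i0.
move=> {ih hi i_f fe f0} {}h {}i {}e {}f e0 ih hi f0 i_f fe i0.
have -> : 1 - f / e = (e - f) / e by field; rewrite gt_eqF.
(* Over the common denominator [e], both [h] and [i * (e / f)] lie between [i] and [i + (e - f)]. *)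
have -> : h / e - i / f = (h - i * (e / f)) / e by field; rewrite !gt_eqF.
rewrite normrM [X in _ * X]ger0_norm ?invr_ge0 ?(ltW e0) //.
rewrite ler_wpM2r ?invr_ge0 ?(ltW e0) //.
have ef : 1 <= e / f by rewrite ler_pdivlMr ?mul1r.
have h1 : i * (e / f) - i <= e - f.
  have -> : i * (e / f) - i = i / f * (e - f) by field; rewrite gt_eqF.
  have i1 : i / f <= 1 by rewrite ler_pdivrMr ?mul1r.
  have i2 : 0 <= i / f by rewrite divr_ge0 // ltW.
  by rewrite ler_piMl // subr_ge0.
have h2 : i <= i * (e / f) by rewrite ler_peMr.
rewrite ler_norml; lra.
Qed.

(** * Mean and concentration of densities in a random sample *)

Lemma injhom_sample (F G : sgraph) (k : nat) (k0 : (0 < k)%N) (S : ksubset G k) :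
  injhom F (sample k0 S) =
  #|[pred h : {ffun F -> G} | is_hom h && injectiveb h & [forall x, h x \in val S]]|.
Proof.
rewrite -(card_ffun_sub (val S) [pred h : {ffun F -> G} | is_hom h && injectiveb h]).
apply: eq_card => u; rewrite !inE; congr andb.
  by apply/is_homP/is_homP => H x y xy; have := H x y xy; rewrite ?ffunE.
apply/injectiveP/injectiveP => H x y.
  by rewrite !ffunE => /val_inj /H.
by move=> uxy; apply: H; rewrite !ffunE uxy.
Qed.

(** The sample is an unbiased estimator of the injective density, since each injective homomorphism
    survives in equally many samples. *)
Lemma average_injhom_density (R : realType) (F G : sgraph) (k : nat)
    (k0 : (0 < k)%N) : (#|F| <= k <= #|G|)%N ->
  \sum_(S : ksubset G k) injhom_density R F (sample k0 S) =
  #|{: ksubset G k}|%:R * injhom_density R F G.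
Proof.
move=> mkn; have /andP[mk kn] := mkn.
have := sum_inj_ksubset (fun h : {ffun F -> G} => is_hom h) mkn.
under eq_bigr do rewrite -(injhom_sample F k0).
rewrite -/(injhom F G) => e.
have cS (S : ksubset G k) : #|sample k0 S| = k.
  by rewrite /= card_sig (eqP (valP S)).
have := bin_ffact_sub mkn; rewrite -(card_ksubset kn).
under eq_bigr do rewrite /injhom_density cS.
rewrite -mulr_suml -natr_sum {}e /injhom_density.
have f1 : 0 < (k ^_ #|F|)%:R :> R by rewrite ltr0n ffact_gt0.
have f2 : 0 < (#|G| ^_ #|F|)%:R :> R by rewrite ltr0n ffact_gt0 (leq_trans mk).
move=> /(congr1 (fun n => n%:R : R)); rewrite !natrM => e.
apply: (mulIf (lt0r_neq0 f1)); apply: (mulIf (lt0r_neq0 f2)).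
rewrite divfK ?gt_eqF // -[LHS]mulrA {}e.
by field; rewrite gt_eqF.
Qed.

(** Passing to injective densities costs [#|F| ^ 2 / k] in each sample, and no more than that in [G]
    because [k <= #|G|]; hence the factor 2. *)
Lemma average_hom_density (R : realType) (F G : sgraph) (k : nat)
    (k0 : (0 < k)%N) : (#|F| <= k <= #|G|)%N ->
  `|(\sum_(S : ksubset G k) hom_density R F (sample k0 S)) -
      #|{: ksubset G k}|%:R * hom_density R F G| <=
  #|{: ksubset G k}|%:R * (2 * (#|F| ^ 2)%:R / k%:R).
Proof.
move=> mkn; have /andP[mk kn] := mkn.
set N := #|{: ksubset G k}|%:R; set b := (#|F| ^ 2)%:R.
have -> : N * (2 * b / k%:R) = N * (b / k%:R) + N * (b / k%:R).
  by rewrite -!mulrA; ring.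
apply: (le_trans (ler_distD (N * injhom_density R F G) _ _)); apply: lerD.
  rewrite -(average_injhom_density R k0 mkn) -sumrB.
  apply: le_trans (ler_norm_sum _ _ _) _.
  rewrite /N mulr_natl -sumr_const; apply: ler_sum => S _.
  apply: le_trans (hom_injhom_density _ _ _) _.
  by rewrite /= card_sig (eqP (valP S)).
rewrite -mulrBr normrM ger0_norm // ler_wpM2l // distrC.
apply: le_trans (hom_injhom_density _ _ _) _.
by rewrite ler_wpM2l // lef_pV2 ?posrE ?ltr0n ?vert_gt0 // ler_nat.
Qed.

(* Second moment method: [t(F + F, _) = t(F, _) ^ 2], so the variance only
   involves the averages of two homomorphism densities. *)
Lemma variance_hom_density (R : realType) (F G : sgraph) (k : nat)
    (k0 : (0 < k)%N) : (#|F| + #|F| <= k <= #|G|)%N ->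
  \sum_(S : ksubset G k) (hom_density R F G - hom_density R F (sample k0 S)) ^+ 2 <=
  #|{: ksubset G k}|%:R * (12 * (#|F| ^ 2)%:R / k%:R).
Proof.
move=> mkn; have /andP[mk kn] := mkn.
have mkn1 : (#|F| <= k <= #|G|)%N by rewrite kn (leq_trans _ mk) // leq_addr.
have k0R : 0 < k%:R :> R by rewrite ltr0n.
have := average_hom_density R k0 mkn1.
have := @average_hom_density R (graph_union F F) G k k0.
rewrite card_sum => /(_ mkn); rewrite hom_density_union.
under eq_bigr do rewrite hom_density_union.
have -> : ((#|F| + #|F|) ^ 2)%:R = 4 * (#|F| ^ 2)%:R :> R.
  by rewrite -natrM; congr (_%:R); lia.
set N := #|{: ksubset G k}|%:R; set b := (#|F| ^ 2)%:R; set t := hom_density R F G.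
set s1 := \sum_S hom_density R F _; set s2 := \sum_S _ * _ => h2 h1.
have -> : \sum_(S : ksubset G k) (t - hom_density R F (sample k0 S)) ^+ 2 =
    N * t ^+ 2 - 2 * t * s1 + s2.
  rewrite /s1 /s2 mulr_sumr /N mulr_natl -sumr_const -sumrB -big_split /=.
  by apply: eq_bigr => S _; ring.
have t0 : 0 <= t := hom_density_ge0 R F G.
have t1 : t <= 1 := hom_density_le1 R F G.
have e1 : 12 * b / k%:R = 12 * (b / k%:R) by rewrite mulrA.
have e2 : 2 * b / k%:R = 2 * (b / k%:R) by rewrite mulrA.
have e3 : 2 * (4 * b) / k%:R = 8 * (b / k%:R) by rewrite !mulrA; congr (_ * _ / _); ring.
rewrite {}e1 {}e2 {}e3 in h1 h2 *.
have c0 : 0 <= b / k%:R by rewrite divr_ge0.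
have N0 : 0 <= N by rewrite ler0n.
move: h1 h2; rewrite !ler_norml; move: (b / k%:R) c0 => c c0.
move=> /andP[h1 _] /andP[_ h2].
have Nc : 0 <= N * c by rewrite mulr_ge0.
(* The sum is [2 * t * (N * t - s1) + (s2 - N * t ^+ 2)]. The first term is at most [4 * (N * c)]
   and the second at most [8 * (N * c)], whence the constant 12. *)
have : t * (N * t - s1) <= 1 * (N * (2 * c)).
  have [x0|/ltW x0] := lerP 0 (N * t - s1); first by rewrite ler_pM //; lra.
  by rewrite (@le_trans _ _ 0) ?mulr_ge0_le0 //; lra.
lra.
Qed.

(** Chebyshev's inequality, from the variance bound. *)
Lemma sample_prob_hom_density (R : realType) (F G : sgraph) (k : nat)
    (k0 : (0 < k)%N) (d : R) : 0 < d -> (#|F| + #|F| <= k <= #|G|)%N ->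
  sample_prob R G k0 (fun H => d < `|hom_density R F G - hom_density R F H|) <=
  12 * (#|F| ^ 2)%:R / k%:R / d ^+ 2.
Proof.
move=> d0 mkn; have /andP[mk kn] := mkn.
have N0 : 0 < #|{: ksubset G k}|%:R :> R by rewrite ltr0n card_ksubset // bin_gt0.
have d20 : 0 < d ^+ 2 by rewrite exprn_gt0.
rewrite /sample_prob ler_pdivrMr // mulrC mulrA ler_pdivlMr //.
apply: le_trans (variance_hom_density R k0 mkn).
set P := [pred S : ksubset G k | _].
rewrite (bigID P) /= -[leLHS]addr0; apply: lerD; last first.
  by apply: sumr_ge0 => S _; rewrite sqr_ge0.
rewrite mulr_natl -sumr_const; apply: ler_sum => S.
rewrite inE -[leRHS]real_normK ?num_real // => /ltW dS.
by rewrite lerXn2r // nnegrE // ltW.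
Qed.

(** * Graphs on ordinals and a countable enumeration of all graphs *)

Section PatternGraph.
Variables (k : nat) (A : {set 'I_k.+1 * 'I_k.+1}).

(** Symmetrising and dropping the diagonal turns every set of ordered pairs into a graph, so
    patterns form a plain finite type. *)
Definition pattern_adj : rel 'I_k.+1 := fun x y =>
  (x != y) && (((x, y) \in A) || ((y, x) \in A)).

Lemma pattern_adj_sym : symmetric pattern_adj.
Proof. by move=> x y; rewrite /pattern_adj eq_sym orbC. Qed.

Lemma pattern_adj_irr : irreflexive pattern_adj.
Proof. by move=> x; rewrite /pattern_adj eqxx. Qed.

Lemma pattern_vert_gt0 : (0 < #|'I_k.+1|)%N.
Proof. by rewrite card_ord. Qed.

Definition pattern_graph : sgraph :=
  SGraph pattern_adj_sym pattern_adj_irr pattern_vert_gt0.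

End PatternGraph.

Definition pattern (k : nat) (G : sgraph) (h : 'I_k.+1 -> G) :
  {set 'I_k.+1 * 'I_k.+1} := [set p | adj (h p.1) (h p.2)]%SET.

Lemma adj_pattern (k : nat) (G : sgraph) (h : 'I_k.+1 -> G) (x y : 'I_k.+1) :
  @adj (pattern_graph (pattern h)) x y = adj (h x) (h y).
Proof.
rewrite /= /pattern_adj !inE /= (adj_sym (h y)) orbb.
by case: eqVneq => // ->; rewrite adj_irr.
Qed.

(** The pairs of a size and a pattern form a countable type; numbers that code nothing give the
    one-node graph. *)
Definition enum_graph (j : nat) : sgraph :=
  pattern_graph (tagged (odflt (existT _ 0 finset.set0)
    (unpickle j : option {k : nat & {set 'I_k.+1 * 'I_k.+1}}))).

Lemma enum_graph_surj (F : sgraph) : exists j, isomorphic (enum_graph j) F.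
Proof.
case cF : #|F| => [|k]; first by have := vert_gt0 F; rewrite cF.
pose h (i : 'I_k.+1) : F := enum_val (cast_ord (esym cF) i).
exists (pickle (existT (fun k => {set 'I_k.+1 * 'I_k.+1}) k (pattern h))).
rewrite /enum_graph pickleK /=; exists h; last by move=> x y; rewrite adj_pattern.
exists (fun x => cast_ord cF (enum_rank x)) => x.
  by rewrite /h enum_valK cast_ordKV.
by rewrite /h cast_ordK enum_rankK.
Qed.

Lemma left_convergent_enum (R : realType) (G : nat -> sgraph) :
  (forall j, cvg ((fun n => hom_density R (enum_graph j) (G n)) @ \oo)%classic) ->
  left_convergent R G.
Proof.
move=> H F; have [j /hom_density_isol jF] := enum_graph_surj F.
have -> : (fun n => hom_density R F (G n)) =
    (fun n => hom_density R (enum_graph j) (G n)).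
  by apply/funext => n; rewrite jF.
exact: H.
Qed.

(** * Compactness and interlacing *)

Lemma ultra_fmap (T U : Type) (f : T -> U) (F : set_system T) :
  UltraFilter F -> UltraFilter (f @ F)%classic.
Proof.
move=> FU; split=> [|G GF FG]; first exact: fmap_proper_filter.
apply/seteqP; split => // A GA.
have [//|FnA] := in_ultra_setVsetC (f @^-1` A)%classic FU.
have /FG GnA : (f @ F)%classic (~` A)%classic by [].
by have [x []] := filter_ex (filterI GA GnA).
Qed.

(* Along an ultrafilter finer than [\oo], all the densities converge at once. *)
Lemma exists_limit_densities (R : realType) (G : nat -> sgraph) :
  exists p : nat -> R, forall n, exists2 m, (n <= m)%N &
    forall j, (j < n)%N -> `|p j - hom_density R (enum_graph j) (G m)| < n.+1%:R^-1.
Proof.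
have [U [UU ooU]] := @ultraFilterLemma _ \oo%classic _.
have UP : ProperFilter U by case: UU.
have lim_j j : exists p : R,
    ((fun n => hom_density R (enum_graph j) (G n)) @ U --> p)%classic.
  (* Densities lie in the compact interval [0, 1], where every ultrafilter converges. *)
  have := @segment_compact R 0 1; rewrite compact_ultra.
  move=> /(_ _ (ultra_fmap (fun n => hom_density R (enum_graph j) (G n)) UU)).
  case=> [|p [_ hp]]; last by exists p.
  rewrite /fmap /=; apply: filterS (filterT (F := U)) => n _ /=.
  by rewrite in_itv /= hom_density_ge0 hom_density_le1.
have [p hp] := boolp.choice lim_j; exists p => n.
have n0 : 0 < n.+1%:R^-1 :> R by rewrite invr_gt0.
have near_j (j : 'I_n) :
    \forall m \near U, `|p j - hom_density R (enum_graph j) (G m)| < n.+1%:R^-1.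
  by have /cvgrPdist_lt/(_ _ n0) := hp j.
have near_n : \forall m \near U, (n <= m)%N by apply: ooU; exact: nbhs_infty_ge.
have [m [nm hm]] := filter_ex (filterI near_n (filter_forall _ near_j)).
by exists m => // j jn; exact: (hm (Ordinal jn)).
Qed.

(** Otherwise each [N] has a violating pair. Select pairs whose first graphs have converging
    densities and interlace both graphs of each pair: the resulting sequence converges, while [f]
    jumps by more than [eps] infinitely often. *)
Lemma uniform_of_convergent (R : realType) (f : sgraph -> R) (eps : R) :
  (forall G : nat -> sgraph, order_to_infty G -> left_convergent R G ->
    cvg ((fun n => f (G n)) @ \oo)%classic) -> 0 < eps ->
  exists N, forall G H : sgraph, (N <= #|G|)%N -> (N <= #|H|)%N ->
    (forall j, (j < N)%N -> `|hom_density R (enum_graph j) G -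
       hom_density R (enum_graph j) H| <= N.+1%:R^-1) ->
    `|f G - f H| <= eps.
Proof.
move=> fcvg eps0; apply: contrapT => /forallNP bad.
have exGH : forall N, exists GH : sgraph * sgraph,
    [/\ (N <= #|GH.1|)%N, (N <= #|GH.2|)%N,
     (forall j, (j < N)%N -> `|hom_density R (enum_graph j) GH.1 -
       hom_density R (enum_graph j) GH.2| <= N.+1%:R^-1) &
     eps < `|f GH.1 - f GH.2|].
  move=> N; apply: contrapT => noGH; apply: (bad N) => G H hG hH hj.
  by rewrite leNgt; apply/negP => hf; apply: noGH; exists (G, H).
have [GH hGH] := boolp.choice exGH.
have [p exm] := exists_limit_densities R (fun n => (GH n).1).
have {}exm n : exists m, (n <= m)%N /\ forall j, (j < n)%N ->
    `|p j - hom_density R (enum_graph j) (GH m).1| < n.+1%:R^-1.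
  by have [m] := exm n; exists m.
have [m hm] := boolp.choice exm.
(* Positions [2n] and [2n + 1] hold the two graphs of the pair selected at stage [n]. *)
pose K i := if odd i then (GH (m i./2)).2 else (GH (m i./2)).1.
have mge n : (n <= m n)%N by have [] := hm n.
have Kinf : order_to_infty K.
  apply/cvgnyPge => A; near=> i.
  have iA : (A <= i./2)%N by rewrite geq_half_double; near: i; exact: nbhs_infty_ge.
  apply: (leq_trans iA); apply: leq_trans (mge _) _.
  by rewrite /K; case: ifP => _; have [] := hGH (m i./2).
have Kcvg : left_convergent R K.
  apply: left_convergent_enum => j; apply/cvg_ex; exists (p j).
  apply/cvgrPdist_lt => e e0.
  (* At stage [n] the first graph is within [1 / n.+1] of the limit and the second within another
     [1 / (m n).+1], so [2 / n.+1 < e] suffices. *)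
  have [M hM] : exists M : nat, 2 / e < M%:R.
    by exists (Num.bound (2 / e)); apply: archi_boundP; rewrite divr_ge0 ?ltW.
  near=> i.
  have [ij iM] : (j < i./2)%N /\ (M <= i./2)%N.
    by split; rewrite geq_half_double; near: i; exact: nbhs_infty_ge.
  move: (hm i./2) (hGH (m i./2)) ij iM; rewrite /K; move: (i./2) => n.
  move=> [nm hn] [_ _ hd _] jn nM.
  have h1 := hn j jn; have h2 := hd j (leq_trans jn nm).
  have nR : 0 < n.+1%:R :> R by rewrite ltr0n.
  have h3 : 2 * n.+1%:R^-1 < e.
    rewrite ltr_pdivrMr // mulrC -ltr_pdivrMr //; apply: lt_le_trans hM _.
    by rewrite ler_nat leqW.
  have h4 : (m n).+1%:R^-1 <= n.+1%:R^-1 :> R.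
    by rewrite lef_pV2 ?posrE ?ltr0n // ler_nat.
  have h5 : 0 < n.+1%:R^-1 :> R by rewrite invr_gt0.
  move: (n.+1%:R^-1 : R) ((m n).+1%:R^-1 : R) h1 h2 h3 h4 h5 => c c' h1 h2 h3 h4 h5.
  case: ifP => _; last by apply: (lt_trans h1); lra.
  apply: (le_lt_trans (ler_distD (hom_density R (enum_graph j) (GH (m n)).1) _ _)).
  by apply: (lt_le_trans (ltr_leD h1 h2)); lra.
have /cvg_ex[l /cvgrPdist_lt/(_ (eps / 2))] := fcvg K Kinf Kcvg.
case; first by rewrite divr_gt0.
move=> M _ hM.
(* These two consecutive terms form one violating pair, yet both values of [f] are within [eps / 2]
   of [l]. *)
have /= h1 := hM M.*2; have /= h2 := hM M.*2.+1.
rewrite /K /= uphalf_double odd_double doubleK /= in h1 h2.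
have M2 : (M <= M.*2)%N by rewrite -addnn leq_addr.
have {}h1 := h1 M2; have {}h2 := h2 (leqW M2).
have [_ _ _] := hGH (m M); apply/negP; rewrite -leNgt.
apply: (le_trans (ler_distD l _ _)); rewrite distrC.
by apply: (le_trans (lerD (ltW h1) (ltW h2))); lra.
Unshelve. all: by end_near.
Qed.

(** * Testability from convergence *)

Lemma sample_prob_union (R : realType) (G : sgraph) (k : nat) (k0 : (0 < k)%N)
    (I : finType) (P : pred sgraph) (Q : I -> pred sgraph) :
  (forall S : ksubset G k, P (sample k0 S) -> exists i, Q i (sample k0 S)) ->
  sample_prob R G k0 P <= \sum_i sample_prob R G k0 (Q i).
Proof.
move=> PQ; rewrite /sample_prob -mulr_suml ler_wpM2r ?invr_ge0 // -natr_sum ler_nat.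
under [leqRHS]eq_bigr do rewrite -sum1_card big_mkcond /=.
rewrite exchange_big /= -sum1_card big_mkcond; apply: leq_sum => S _.
case: ifP => // /PQ[i Qi]; rewrite (bigD1 i) //= [_ \in _]Qi.
exact: leq_addr.
Qed.

Lemma testable_of_convergent (R : realType) (f : sgraph -> R) :
  graph_parameter f ->
  (forall G : nat -> sgraph, order_to_infty G -> left_convergent R G ->
    cvg ((fun n => f (G n)) @ \oo)%classic) ->
  testable f.
Proof.
move=> fpar fcvg eps eps0.
have [N hN] := uniform_of_convergent fcvg eps0.
pose M := (\max_(j < N) #|enum_graph j|)%N.
(* With deviation [1 / N.+1], a sample size above [B] brings each of the [N] Chebyshev bounds below
   [eps / N.+1]. The other summands of [k] make the sample large enough for [hN] and for the
   variance bound of every tested graph. *)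
pose B : R := 12 * (M ^ 2)%:R * N.+1%:R ^+ 3 / eps.
have B0 : 0 <= B by rewrite !mulr_ge0 // invr_ge0 ltW.
pose k := (N + (M + M) + Num.bound B).+1.
exists k, (ltn0Sn _), f; split => // G kG.
have NG : (N <= #|G|)%N by apply: leq_trans kG; rewrite /k; lia.
pose Q (j : 'I_N) : pred sgraph := fun H =>
  N.+1%:R^-1 < `|hom_density R (enum_graph j) G - hom_density R (enum_graph j) H|.
apply: le_trans (@sample_prob_union R G k (ltn0Sn _) 'I_N _ Q _) _.
  move=> S /= fS; apply: contrapT => /forallNP noQ.
  move: fS; apply/negP; rewrite -leNgt; apply: hN => //.
    by rewrite /= card_sig (eqP (valP S)) /k; lia.
  by move=> j jN; rewrite leNgt; apply/negP; exact: (noQ (Ordinal jN)).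
have N0 : 0 < N.+1%:R :> R by rewrite ltr0n.
apply: (@le_trans _ _ (\sum_(j < N) eps / N.+1%:R)); last first.
  rewrite sumr_const card_ord -[_ *+ N]mulr_natr mulrAC ler_pdivrMr //.
  by rewrite ler_wpM2l ?ler_nat // ltW.
apply: ler_sum => j _; set F := enum_graph j.
have FM : (#|F| <= M)%N by exact: (leq_bigmax (F := fun i : 'I_N => #|enum_graph i|) j).
have kR : B < k%:R.
  by apply: (lt_le_trans (archi_boundP B0)); rewrite ler_nat /k; lia.
have k0 : 0 < k%:R :> R by rewrite ltr0n.
apply: (le_trans (sample_prob_hom_density _ _ _)).
- by rewrite invr_gt0.
- rewrite kG -/F andbT; apply: leq_trans (leq_add FM FM) _; rewrite /k; lia.
apply: (@le_trans _ _ (12 * (M ^ 2)%:R / k%:R / N.+1%:R^-1 ^+ 2)).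
  rewrite ler_wpM2r ?invr_ge0 ?exprn_ge0 // ?invr_ge0 ?(ltW N0) //.
  rewrite ler_wpM2r ?invr_ge0 ?(ltW k0) // ler_wpM2l // ler_nat leq_sqr //.
move: kR; rewrite /B ltr_pdivrMr // => /ltW kR.
rewrite exprVn invrK ler_pdivlMr //.
have -> : 12 * (M ^ 2)%:R / k%:R * N.+1%:R ^+ 2 * N.+1%:R =
    12 * (M ^ 2)%:R * N.+1%:R ^+ 3 / k%:R :> R by ring.
by rewrite ler_pdivrMr // [leRHS]mulrC.
Qed.

(** * Pattern counts and inclusion-exclusion *)

Section PatternCount.
Variables (k : nat) (G : sgraph).

(** Pairs in [l] are prescribed edges and pairs in [l'] prescribed non-edges; lists allow removing
    the non-edges one at a time. *)
Definition edges_count (l l' : seq ('I_k.+1 * 'I_k.+1)) : nat :=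
  #|[pred h : {ffun 'I_k.+1 -> G} | all (fun e => adj (h e.1) (h e.2)) l &
      all (fun e => ~~ adj (h e.1) (h e.2)) l']|.

Definition pattern_count (P : pred {set 'I_k.+1 * 'I_k.+1}) : nat :=
  #|[pred h : {ffun 'I_k.+1 -> G} | P (pattern h)]|.

(** One step of inclusion-exclusion: split the maps according to the adjacency of the pair [e]. *)
Lemma edges_count_cons l e l' :
  edges_count l l' = (edges_count l (e :: l') + edges_count (e :: l) l')%N.
Proof.
rewrite /edges_count -(cardID [pred h : {ffun 'I_k.+1 -> G} | adj (h e.1) (h e.2)]) addnC.
congr addn; apply: eq_card => h; rewrite !inE /=; last by rewrite andbC andbA.
by case: (adj _ _); rewrite ?andbF ?andbT.
Qed.

Lemma edges_count_hom (A : {set 'I_k.+1 * 'I_k.+1}) :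
  (forall x, (x, x) \notin A) ->
  edges_count (enum A) [::] = hom (pattern_graph A) G.
Proof.
move=> Airr; apply: eq_card => h; rewrite !inE /= andbT.
apply/allP/is_homP => [H x y /andP[_ /orP[] xy]|H [x y]].
- by apply: (H (x, y)); rewrite mem_enum.
- by rewrite adj_sym; apply: (H (y, x)); rewrite mem_enum.
rewrite mem_enum => xyA; apply: H; rewrite /= /pattern_adj xyA andbT.
by apply/eqP => xy; have := Airr x; rewrite {2}xy xyA.
Qed.

Lemma edges_count_loop (l l' : seq ('I_k.+1 * 'I_k.+1)) x :
  (x, x) \in l -> edges_count l l' = 0%N.
Proof.
move=> xl; apply: eq_card0 => h; rewrite !inE.
by apply/negP => /andP[/allP/(_ _ xl)]; rewrite adj_irr.
Qed.

Lemma pattern_count_edges (A : {set 'I_k.+1 * 'I_k.+1}) :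
  pattern_count (pred1 A) = edges_count (enum A) (enum (~: A)).
Proof.
apply: eq_card => h; rewrite !inE; apply/eqP/andP => [<-|[/allP H /allP H']].
  by split; apply/allP => -[x y]; rewrite mem_enum !inE.
apply/setP => -[x y]; rewrite inE /=; case: (boolP ((x, y) \in A)) => xyA.
  by apply: (H (x, y)); rewrite mem_enum.
by apply/negbTE/(H' (x, y)); rewrite mem_enum inE.
Qed.

Lemma sum_pattern_count (P : pred {set 'I_k.+1 * 'I_k.+1}) :
  (\sum_(A | P A) pattern_count (pred1 A) = pattern_count P)%N.
Proof.
rewrite /pattern_count -[RHS]sum1_card.
rewrite (partition_big (fun h : {ffun 'I_k.+1 -> G} => pattern h) P) //=.
by apply: eq_bigr => A PA; rewrite -sum1_card; apply: eq_bigl => h;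
  rewrite !inE; case: eqP => [->|]; rewrite ?PA ?andbF.
Qed.

Lemma isomorphic_pattern (S : ksubset G k.+1) (h : {ffun 'I_k.+1 -> G}) :
  injectiveb h -> (forall x, h x \in val S) ->
  isomorphic (pattern_graph (pattern h)) (sample (ltn0Sn k) S).
Proof.
move=> /injectiveP hinj hS.
exists (fun i => exist (fun x => x \in val S) (h i) (hS i)).
  apply: inj_card_bij; first by move=> i j [] /hinj.
  by rewrite card_sig (eqP (valP S)) card_ord.
by move=> x y; rewrite adj_pattern.
Qed.

(* Each [k.+1]-subset is the image of [k.+1!] injections, all of which induce on
   ['I_k.+1] a graph isomorphic to the sample. *)
Lemma card_sample_pattern (P : pred sgraph) :
  (forall F H, isomorphic F H -> P F = P H) -> (k.+1 <= #|G|)%N ->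
  #|[pred h : {ffun 'I_k.+1 -> G} | P (pattern_graph (pattern h)) && injectiveb h]| =
  (#|[pred S : ksubset G k.+1 | P (sample (ltn0Sn k) S)]| * k.+1`!)%N.
Proof.
move=> Piso kG.
have := @sum_inj_ksubset 'I_k.+1 G k.+1 (fun h => P (pattern_graph (pattern h))).
rewrite card_ord leqnn kG subnn bin0 muln1 => /(_ isT) <-.
rewrite -sum_nat_const [RHS]big_mkcond /=; apply: eq_bigr => S _.
rewrite -ffactnn inE.
have [PS|nPS] := boolP (P _).
  have -> : (k.+1 ^_ k.+1)%N =
      #|[set h : {ffun 'I_k.+1 -> G} in ffun_on (mem (val S)) | injectiveb h]%SET|.
    by rewrite card_inj_ffuns_on card_ord (eqP (valP S)).
  rewrite cardsE; apply: eq_card => h; rewrite !inE.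
  apply/andP/andP => [[/andP[_ hi] /forallP hS]|[/forallP hS hi]].
    by split => //; apply/forallP.
  have hS' x : h x \in val S by have := hS x.
  by rewrite hi (Piso _ _ (isomorphic_pattern hi hS')) PS; split => //; apply/forallP.
apply: eq_card0 => h; rewrite !inE; apply/negP => /andP[/andP[Ph hi] /forallP hS].
by move: nPS; rewrite -(Piso _ _ (isomorphic_pattern hi hS)) Ph.
Qed.

(** Injective maps contribute at most the sample probability, since they are at most [#|G| ^ k.+1]
    in number; the error term bounds the share of all non-injective maps. *)
Lemma pattern_count_le_sample_prob (R : realType) (P : pred sgraph) :
  (forall F H, isomorphic F H -> P F = P H) -> (k.+1 <= #|G|)%N ->
  (pattern_count (fun A => P (pattern_graph A)))%:R / (#|G| ^ k.+1)%:R <=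
  sample_prob R G (ltn0Sn k) P + (k.+1 ^ 2)%:R / #|G|%:R.
Proof.
move=> Piso kG.
apply: le_trans (lerD (lexx _) (ffact_expn_ratio R k.+1 (vert_gt0 G))).
pose c := #|[pred S : ksubset G k.+1 | P (sample (ltn0Sn k) S)]|.
rewrite /sample_prob -/c; set N := #|{: ksubset G k.+1}|.
have := card_sample_pattern Piso kG; rewrite -/c => e.
have fN : (#|G| ^_ k.+1)%:R = N%:R * k.+1`!%:R :> R.
  by rewrite /N card_ksubset // -bin_ffact natrM.
have N0 : 0 < N%:R :> R by rewrite ltr0n /N card_ksubset // bin_gt0.
have e0 : 0 < (#|G| ^ k.+1)%:R :> R by rewrite ltr0n expn_gt0 vert_gt0.
have cN : c%:R <= N%:R :> R by rewrite ler_nat max_card.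
have h1 : (pattern_count (fun A => P (pattern_graph A)) <= c * k.+1`! +
    (#|G| ^ k.+1 - #|G| ^_ k.+1))%N.
  have := card_noninj 'I_k.+1 G; rewrite card_ord => <-; rewrite -{}e /pattern_count.
  rewrite -(cardID [pred h : {ffun 'I_k.+1 -> G} | injectiveb h]).
  apply: leq_add; apply: subset_leq_card; apply/fintype.subsetP => h; rewrite !inE.
    by rewrite andbC.
  by case/andP.
rewrite ler_pdivrMr // mulrDl mulrBl mul1r divfK ?gt_eqF // fN.
have : (pattern_count (fun A => P (pattern_graph A)))%:R <=
    c%:R * k.+1`!%:R + ((#|G| ^ k.+1)%:R - N%:R * k.+1`!%:R) :> R.
  by rewrite -fN -natrB ?ffact_le_expn // -natrM -natrD ler_nat.
move=> h; apply: (le_trans h); rewrite lerD2r.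
rewrite mulrAC ler_pdivlMr // -mulrA ler_wpM2l // mulrC -fN ler_nat.
exact: ffact_le_expn.
Qed.

End PatternCount.

(** * Convergence of testable parameters *)

Lemma cvg_edges_count (R : realType) (k : nat) (G : nat -> sgraph)
    (l l' : seq ('I_k.+1 * 'I_k.+1)) : left_convergent R G ->
  cvg ((fun n => (edges_count (G n) l l')%:R / (#|G n| ^ k.+1)%:R : R) @ \oo)%classic.
Proof.
(* The list [l] stays general because each step moves a non-edge into it. This may put a diagonal
   pair in [l]; the count is then 0, a case set apart because [pattern_graph] ignores the
   diagonal. *)
move=> Gcvg; elim: l' l => [|e l' IH] l.
  have [/existsP[x xl]|/existsPn nl] := boolP [exists x, (x, x) \in l].
    under boolp.eq_fun do rewrite (edges_count_loop _ _ xl) mul0r.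
    exact: is_cvg_cst.
  pose A := [set e in l]%SET.
  have eA n : edges_count (G n) l [::] = hom (pattern_graph A) (G n).
    rewrite -edges_count_hom; last by move=> x; rewrite inE.
    apply: eq_card => h; rewrite !inE; congr andb; apply: eq_all_r => u.
    by rewrite mem_enum inE.
  have := Gcvg (pattern_graph A); rewrite /hom_density /= card_ord.
  by under [in X in _ -> X]boolp.eq_fun do rewrite eA.
under boolp.eq_fun => n.
  have -> : (edges_count (G n) l (e :: l'))%:R =
      (edges_count (G n) l l')%:R - (edges_count (G n) (e :: l) l')%:R :> R.
    by rewrite (edges_count_cons _ l e l') natrD addrK.
  rewrite mulrBl; over.
exact: is_cvgB (IH l) (IH (e :: l)).
Qed.

Lemma cvg_pattern_density (R : realType) (k : nat) (G : nat -> sgraph)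
    (A : {set 'I_k.+1 * 'I_k.+1}) : left_convergent R G ->
  cvg ((fun n => (pattern_count (G n) (pred1 A))%:R / (#|G n| ^ k.+1)%:R : R)
    @ \oo)%classic.
Proof.
move=> Gcvg; under boolp.eq_fun do rewrite pattern_count_edges.
exact: cvg_edges_count.
Qed.

Lemma convergent_of_testable (R : realType) (f : sgraph -> R)
    (G : nat -> sgraph) :
  testable f -> order_to_infty G -> left_convergent R G ->
  cvg ((fun n => f (G n)) @ \oo)%classic.
Proof.
move=> ft Ginf Gcvg; apply/cauchy_cvgP/cauchyP => e e0.
(* The bound [e / 3] gives [2 * d < e] for the final estimate; [1 / 10] keeps the total mass [6 * d]
   of bad patterns below 1. *)
pose d : R := Num.min (e / 3) (1 / 10).
have d0 : 0 < d by rewrite lt_min !divr_gt0.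
have d1 : d <= 1 / 10 by rewrite ge_min lexx orbT.
have de : 2 * d < e.
  have : d <= e / 3 by rewrite ge_min lexx.
  by move: e0; lra.
have [[|k] [k0 [est [epar hest]]]] := ft d d0; first by [].
rewrite (bool_irrelevance k0 (ltn0Sn k)) in hest.
pose T := {set 'I_k.+1 * 'I_k.+1}.
(* The law of the pattern of a uniform random map into [G n]. Non-injective maps are included, since
   homomorphism densities control the limits of exactly these probabilities. *)
pose q n (P : pred T) : R := (pattern_count (G n) P)%:R / (#|G n| ^ k.+1)%:R.
pose bad n : pred T := fun A => d < `|f (G n) - est (pattern_graph A)|.
have qsum n P : \sum_(A | P A) q n (pred1 A) = q n P.
  by rewrite /q -mulr_suml -natr_sum sum_pattern_count.
have q1 n : q n xpredT = 1.
  rewrite /q (_ : pattern_count _ _ = (#|G n| ^ k.+1)%N) ?divff //.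
    by rewrite pnatr_eq0 -lt0n expn_gt0 vert_gt0.
  by rewrite /pattern_count -[in RHS](card_ord k.+1) -card_ffun; apply: eq_card.
have q0 n P : 0 <= q n P by rewrite divr_ge0.
have bad_small : \forall n \near \oo%classic, q n (bad n) <= 2 * d.
  have [M hM] : exists M : nat, (k.+1 ^ 2)%:R / d < M%:R.
    by exists (Num.bound ((k.+1 ^ 2)%:R / d)); apply: archi_boundP; rewrite divr_ge0 ?ltW.
  move: (Ginf) => /cvgnyPge/(_ (maxn M k.+1)); apply: filterS => n.
  rewrite geq_max => /andP[MG kG].
  pose P : pred sgraph := fun H => d < `|f (G n) - est H|.
  have Piso F H : isomorphic F H -> P F = P H by move=> FH; rewrite /P (epar _ _ FH).
  apply: (le_trans (pattern_count_le_sample_prob R Piso kG)).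
  have -> : 2 * d = d + d by ring.
  apply: lerD; first exact: hest.
  rewrite ler_pdivrMr ?ltr0n ?vert_gt0 // mulrC -ler_pdivrMr //.
  by apply: (le_trans (ltW hM)); rewrite ler_nat.
(* Two laws that are both [c]-close to [l] at every pattern differ by at most [2 * d] on any set of
   patterns. *)
pose c : R := d / #|{: T}|.+1%:R.
have c0 : 0 < c by rewrite divr_gt0 // ltr0n.
have exl A : exists l : R, \forall n \near \oo%classic, `|l - q n (pred1 A)| < c.
  have /cvg_ex[l /cvgrPdist_lt/(_ c c0) hl] := @cvg_pattern_density R k G A Gcvg.
  by exists l.
have [l hl] := boolp.choice exl.
have near_l : \forall n \near \oo%classic, forall A, `|l A - q n (pred1 A)| < c.
  exact: filter_forall.
pose good n := q n (bad n) <= 2 * d /\ forall A, `|l A - q n (pred1 A)| < c.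
have near_good : \forall n \near \oo%classic, good n by exact: filterI.
(* The limits [l A] transfer the smallness of the bad patterns from [n] to
   [m], so some pattern is bad neither for [n] nor for [m]. *)
have close n m : good n -> good m -> `|f (G n) - f (G m)| < e.
  move=> [bn ln] [bm lm].
  have bm' : q n (bad m) <= 4 * d.
    have : `|q n (bad m) - q m (bad m)| <= 2 * d.
      rewrite -!qsum -sumrB; apply: le_trans (ler_norm_sum _ _ _) _.
      apply: (@le_trans _ _ (\sum_(A : T) 2 * c)).
        rewrite [leRHS](bigID (bad m)) /= -[leLHS]addr0; apply: lerD; last first.
          by apply: sumr_ge0 => A _; rewrite mulr_ge0 // ltW.
        apply: ler_sum => A _; apply: (le_trans (ler_distD (l A) _ _)).
        rewrite distrC (_ : 2 * c = c + c); last by ring.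
        by apply: lerD; apply: ltW.
      rewrite sumr_const -[_ *+ _]mulr_natr -mulrA ler_wpM2l //.
      rewrite /c mulrAC ler_pdivrMr ?ltr0n // ler_wpM2l ?(ltW d0) // ler_nat.
      by rewrite leqW // max_card.
    by rewrite ler_norml => /andP[_]; lra.
  (* Under [q n], of total mass 1, the patterns bad for [n] or for [m] have mass at most
     [2 * d + 4 * d < 1]. *)
  have [A /norP[]] : exists A, ~~ (bad n A || bad m A).
    apply: contrapT => /forallNP all_bad.
    have : q n xpredT <= q n (bad n) + q n (bad m).
      rewrite -!qsum [X in _ <= X + _]big_mkcond [X in _ <= _ + X]big_mkcond -big_split.
      apply: ler_sum => A _ /=; have /negP/negPn := all_bad A.
      by case: (bad n A); case: (bad m A) => //= _; rewrite ?addr0 ?add0r ?lerDl.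
    rewrite q1; lra.
  rewrite /bad -!leNgt => h1 h2.
  apply: (le_lt_trans (ler_distD (est (pattern_graph A)) _ _)).
  rewrite [X in _ + X]distrC; apply: le_lt_trans (lerD h1 h2) _.
  by rewrite (_ : d + d = 2 * d) //; ring.
have [n0 good_n0] := filter_ex near_good; exists (f (G n0)).
by apply: filterS near_good => n /=; exact: close.
Qed.


Theorem proposition2p12 (R : realType) :
  (forall f : sgraph -> R, graph_parameter f ->
     (testable f <->
      forall G : nat -> sgraph, order_to_infty G -> left_convergent R G ->
        cvg ((fun n => f (G n)) @ \oo)%classic))
  /\
  (forall G : nat -> sgraph, order_to_infty G ->
     (left_convergent R G <->
      forall f : sgraph -> R, graph_parameter f -> testable f ->
        cvg ((fun n => f (G n)) @ \oo)%classic)).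
Proof.
split=> [f fpar|G Ginf]; split.
- by move=> ft G; exact: convergent_of_testable.
- exact: testable_of_convergent.
- by move=> Gcvg f _ ft; exact: convergent_of_testable.
move=> H F; apply: H; first exact: hom_density_graph_parameter.
(* The density of [F] converges along convergent sequences by definition, so it is testable. *)
apply: testable_of_convergent; first exact: hom_density_graph_parameter.
by move=> G' _ /(_ F).
Qed.
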